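(* For every $m\in\mathbb{N}$, $$w(\Lambda_m^*|\mathcal{F}_m^* )=w(\Lambda_m|\mathcal{F}_m),$$ where $\mathcal{F}_m$ and $\mathcal{F}_m^*$ are the explicit classes of functions defined in the context.
   Context: $\mathbb{N}=\{1,2,3,\dots\}$; $|\cdot|$ applied to a set denotes Lebesgue measure; $\mathbf 1$ denotes an indicator function. For $m\in\mathbb{N}$ and $f\in L^1([0,\infty))$, $t>0$, $$\Lambda_m f(t)=\frac{1+m}{t^{1+m/2}}\int_0^t f(s)s^{m/2}\,ds-f(t),\qquad \Lambda_m^* f(t)=(1+m)\,t^{m/2}\int_t^\infty \frac{f(s)\,ds}{s^{1+m/2}}-f(t).$$ For an operator $T$ on $L^1([0,\infty))$ and a class $\mathcal{F}\subset L^1([0,\infty))$, $$w(T|\mathcal{F})=\sup\Bigl\{\frac{|\{t\in[0,\infty):|Tf(t)|\ge 1\}|}{\|f\|_{L^1([0,\infty))}}: f\in\mathcal{F},\ \|f\|_{L^1([0,\infty))}\ne 0\Bigr\}.$$ Class $\mathcal{F}_m$: all functions $f:[0,\infty)\to\mathbb{R}$ of the form $$f(t)=\Bigl(\tfrac{2+m}{m}-\tfrac{2(1+m)}{m}t^{m/2}\Bigr)\mathbf 1_{\{t\in(1,b]\}}+\Bigl(-\tfrac{2+m}{m}+D\,t^{m/2}\Bigr)\mathbf 1_{\{t\in(b,d]\}}$$ for some $1<b<d$, where $D=D(b,m)=\frac{2(1+m)}{m}(2b^{-m/2}-1)$, and such that $D>0$ and $$-\tfrac{2+m}{m}+D\,b^{m/2}<0<-\tfrac{2+m}{m}+D\,d^{m/2}<2.$$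 Class $\mathcal{F}_m^*$: all functions $f_*:[0,\infty)\to\mathbb{R}$ of the form $$f_*(t)=\Bigl(-\tfrac{m}{2+m}+D_*\,t^{-1-m/2}\Bigr)\mathbf 1_{\{t\in(d_*,b_*]\}}+\Bigl(\tfrac{m}{2+m}-\tfrac{2(1+m)}{2+m}t^{-1-m/2}\Bigr)\mathbf 1_{\{t\in(b_*,1]\}}$$ for some $0<d_*<b_*<1$, where $D_*=D_*(b_*,m)=\frac{2(1+m)}{2+m}(2b_*^{1+m/2}-1)$, and such that $D_*>0$ and $$2>-\tfrac{m}{2+m}+D_*\,d_*^{-1-m/2}>0>-\tfrac{m}{2+m}+D_*\,b_*^{-1-m/2}.$$ *)

(* Defs.v *)
From mathcomp Require Import all_boot all_order all_algebra.
From mathcomp Require Import all_classical all_reals all_analysis.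
Import Order.TTheory GRing.Theory Num.Theory.
Import numFieldNormedType.Exports.

Set Implicit Arguments.
Unset Strict Implicit.
Unset Printing Implicit Defensive.

Local Open Scope classical_set_scope.
Local Open Scope ring_scope.

(* A function on [0, +oo[ is represented by a total function R -> R of which
   only the restriction to [0, +oo[ is ever used. *)

Section Defs.
Variable R : realType.
Local Notation mu := (@lebesgue_measure R).

(* At t = 0, where both operators are undefined, these have arbitrary values;
   this has no effect on the measure of a superlevel set. *)
Definition Lambda (m : nat) (f : R -> R) (t : R) : R :=
  (1 + m%:R) / t `^ (1 + m%:R / 2) *
    \int[mu]_(s in `[0, t]) (f s * s `^ (m%:R / 2)) - f t.

Definition Lambda_star (m : nat) (f : R -> R) (t : R) : R :=
  (1 + m%:R) * t `^ (m%:R / 2) *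
    \int[mu]_(s in `[t, +oo[) (f s / s `^ (1 + m%:R / 2)) - f t.

Definition L1norm (f : R -> R) : \bar R :=
  (\int[mu]_(t in `[0%R, +oo[) `|f t|%:E)%E.

(* Intended for classes F of functions that are integrable on [0, +oo[. *)
Definition w (T : (R -> R) -> R -> R) (F : set (R -> R)) : \bar R :=
  ereal_sup [set (mu [set t : R | (0 <= t)%R /\ (1 <= `|T f t|)%R] / L1norm f)%E
            | f in [set f | F f /\ L1norm f <> 0%E]].

Definition Dcoef (m : nat) (b : R) : R :=
  2 * (1 + m%:R) / m%:R * (2 * b `^ (- (m%:R / 2)) - 1).

Definition Fclass (m : nat) : set (R -> R) := [set f | exists b d : R,
  [/\ 1 < b < d,
      0 < Dcoef m b,
      - ((2 + m%:R) / m%:R) + Dcoef m b * b `^ (m%:R / 2) < 0,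
      0 < - ((2 + m%:R) / m%:R) + Dcoef m b * d `^ (m%:R / 2) < 2 &
      forall t : R, 0 <= t -> f t =
        ((2 + m%:R) / m%:R - 2 * (1 + m%:R) / m%:R * t `^ (m%:R / 2))
          * \1_(`]1, b]) t
        + (- ((2 + m%:R) / m%:R) + Dcoef m b * t `^ (m%:R / 2))
          * \1_(`]b, d]) t]].

Definition Dcoef_star (m : nat) (b : R) : R :=
  2 * (1 + m%:R) / (2 + m%:R) * (2 * b `^ (1 + m%:R / 2) - 1).

Definition Fclass_star (m : nat) : set (R -> R) := [set f | exists b d : R,
  [/\ 0 < d < b /\ b < 1,
      0 < Dcoef_star m b,
      - (m%:R / (2 + m%:R)) + Dcoef_star m b * b `^ (- 1 - m%:R / 2) < 0,
      0 < - (m%:R / (2 + m%:R)) + Dcoef_star m b * d `^ (- 1 - m%:R / 2) < 2 &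
      forall t : R, 0 <= t -> f t =
        (- (m%:R / (2 + m%:R)) + Dcoef_star m b * t `^ (- 1 - m%:R / 2))
          * \1_(`]d, b]) t
        + (m%:R / (2 + m%:R)
           - 2 * (1 + m%:R) / (2 + m%:R) * t `^ (- 1 - m%:R / 2))
          * \1_(`]b, 1]) t]].

End Defs.

(* Main.v *)
Require Import Defs.
From mathcomp Require Import all_boot all_order all_algebra.
From mathcomp Require Import all_classical all_reals all_analysis.
From mathcomp Require Import measurable_realfun ring lra.
Import Order.TTheory GRing.Theory Num.Theory.
Import numFieldNormedType.Exports.

Set Implicit Arguments.
Unset Strict Implicit.
Unset Printing Implicit Defensive.

Local Open Scope classical_set_scope.
Local Open Scope ring_scope.

(** Both suprema equal [1 / theta] for the same [theta].  Write [a = m / 2].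
    For [f] in either class the set where [|T f| >= 1] is exactly the interval
    supporting [f], and if [c] is the zero of [f] between [b] and [d], the
    difference between the norm of [f] and [theta] times the length of the
    support is a nonnegative combination of three Young slacks
    [a X^(1+a) + Y^(1+a) - (1+a) X^a Y], as soon as [theta] belongs to a tuple
    [(theta, x, y, r)] solving the stationarity equations
    [optimal_parameters].  All three slacks vanish at one member of each class,
    so the supremum is attained there.  The stationarity system is the same for
    the two classes, and it has a solution with [1/2 <= theta <= 1] by the
    intermediate value theorem, the signs at both ends being Bernoulli's
    inequality. *)

(** * Powers *)

(** Young's inequality for the product of [x^a] and [y], with conjugate exponents [(1 + a) / a] and
    [1 + a]. Equality holds at [x = y], which lets the slacks vanish at an extremal function. *)
Lemma powR_young (R : realType) (a x y : R) : 0 < a -> 0 < x -> 0 < y ->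
  (1 + a) * (x `^ a * y) <= a * (x * x `^ a) + y * y `^ a.
Proof.
move=> a0 x0 y0.
have a10 : 0 < 1 + a by lra.
have p0 : 0 < (1 + a) / a by rewrite divr_gt0.
have E : ((1 + a) / a)^-1 + (1 + a)^-1 = 1 by field; lra.
have := @conjugate_powR R (x `^ a) y _ _ (powR_ge0 _ _) (ltW y0) p0 a10 E.
rewrite -powRrM (_ : a * _ = 1 + a); last by field; lra.
rewrite !powRD ?gt_eqF ?implybT//.
rewrite !powRr1 ?(ltW x0) ?(ltW y0)// => h.
apply: le_trans (ler_wpM2l (ltW a10) h) _.
by rewrite le_eqVlt; apply/orP; left; apply/eqP; field; lra.
Qed.

(** This is Young's inequality with [a = p - 1] and first argument 1. *)
Lemma powR_bernoulli (R : realType) (p x : R) : 1 < p -> 0 < x ->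
  1 + p * (x - 1) <= x `^ p.
Proof.
move=> p1 x0; have := @powR_young R (p - 1) 1 x.
rewrite subr_gt0 => /(_ p1 ltr01 x0).
by rewrite powR1 mulr_powRB1 ?(ltW x0) ?(lt_trans ltr01)//; lra.
Qed.

(* Strictness comes from squaring the weak inequality at the square root of x. *)
Lemma powR_bernoulli_lt (R : realType) (p x : R) : 1 < p -> 0 < x -> x != 1 ->
  0 <= 1 + p * (x - 1) -> 1 + p * (x - 1) < x `^ p.
Proof.
move=> p1 x0 x1 hx; set s := Num.sqrt x.
have s0 : 0 < s by rewrite sqrtr_gt0.
have sx : x = s * s by rewrite -expr2 sqr_sqrtr// ltW.
have s1 : s != 1 by apply: contra x1 => /eqP E; rewrite sx E mulr1.
have hs : 0 <= 1 + p * (s - 1).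
  have [s_ge|s_lt] := lerP 1 s; first by rewrite addr_ge0// mulr_ge0//; lra.
  have : x <= s by rewrite sx ger_pMl// ltW.
  by rewrite -(ler_pM2l (lt_trans ltr01 p1)); lra.
have h := powR_bernoulli p1 s0.
rewrite {2}sx powRM ?ltW//; apply: lt_le_trans (ler_pM hs hs h h).
(* The square of [1 + p * (s - 1)] exceeds [1 + p * (s * s - 1)] by exactly this amount. *)
have : 0 < p * (p - 1) * (s - 1) ^+ 2.
  by rewrite mulr_gt0 ?exprn_even_gt0 ?subr_eq0//=; nra.
by rewrite sx; lra.
Qed.

Lemma continuous_powRr (R : realType) (e x : R) : 0 < x ->
  {for x, continuous (fun t : R => t `^ e)}.
Proof.
move=> x0; apply: differentiable_continuous; apply/derivable1_diffP.
by have [] := is_derive1_powR e x0.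
Qed.

Lemma powRV (R : realType) (x e : R) : 0 <= x -> x^-1 `^ e = (x `^ e)^-1.
Proof.
by move=> x0; rewrite -[x^-1]powR_inv1// -powRrM mulrC powRrM powR_inv1 ?powR_ge0.
Qed.

Lemma continuous_powR_comp (R : realType) (g : R -> R) (e x : R) : 0 < g x ->
  {for x, continuous g} -> {for x, continuous (fun t => g t `^ e)}.
Proof.
move=> gx cg.
exact: (@continuous_comp _ _ _ g (fun t : R => t `^ e) x cg (continuous_powRr gx)).
Qed.

Lemma continuous_affine (R : realType) (k l x : R) :
  {for x, continuous (fun t : R => k + l * t)}.
Proof.
by apply: cvgD; [exact: cvg_cst | apply: cvgM; [exact: cvg_cst | exact: cvg_id]].
Qed.

(** The stationarity system reduced to one equation, with [p = (1 + a) / a]. Here [1 + t / p] is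
    [x^a] and [(1 + p * t)^(1/p)] is [y^a]; the window on the latter says that [r^a], the base of
    the last power, lies strictly between 0 and 1. *)
Lemma exists_stationary_theta (R : realType) (p : R) : 1 < p -> exists t : R,
  [/\ 2^-1 <= t <= 1, (p + 2) / (p + 1) < (1 + p * t) `^ p^-1 < 2 &
   (1 + t / p) `^ p +
    (p + 1)^-1 * ((p + 1) / p * (2 - (1 + p * t) `^ p^-1)) `^ p = 2].
Proof.
move=> p1.
have p0 : 0 < p by lra.
have rootKV z : 0 < z -> (z `^ p) `^ p^-1 = z.
  by move=> z0; rewrite -powRrM mulfV ?gt_eqF// powRr1// ltW.
have pV0 : 0 < p^-1 by rewrite invr_gt0.
(* The claim amounts to [s^p < 1 + p * t]. Bernoulli bounds powers from below, so it is applied to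
   [s^-1], giving [s^p < (p + 2) / 2]. *)
have lo t : 2^-1 <= t -> (p + 2) / (p + 1) < (1 + p * t) `^ p^-1.
  move=> t2; set s := (p + 2) / (p + 1).
  have s0 : 0 < s by rewrite divr_gt0; lra.
  rewrite -[s](rootKV _ s0).
  apply: gt0_ltr_powR => //; rewrite ?nnegrE ?powR_ge0//; first by nra.
  have sV : 1 + p * (s^-1 - 1) = 2 / (p + 2) by rewrite /s; field; lra.
  have : 2 / (p + 2) < s^-1 `^ p.
    rewrite -sV; apply: powR_bernoulli_lt => //; rewrite ?invr_gt0//.
      rewrite invr_eq1 /s; apply/eqP => E.
      have : (p + 2) / (p + 1) * (p + 1) = p + 2 by field; lra.
      by rewrite E; lra.
    by rewrite sV divr_ge0; lra.
  rewrite powRV ?(ltW s0)// => h.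
  have sp0 : 0 < s `^ p by rewrite powR_gt0.
  move: h; rewrite ltr_pdivrMr ?addr_gt0// mulrC -ltr_pdivrMr ?invr_gt0// invrK.
  by move=> h; nra.
have two0 : (0 : R) < 2 by [].
(* Here [1 + p * t <= 1 + p < 2^p], by Bernoulli at 2. *)
have hi t : 0 <= t <= 1 -> (1 + p * t) `^ p^-1 < 2.
  move=> /andP[t0 t1]; rewrite -[ltRHS](rootKV _ two0).
  apply: gt0_ltr_powR => //; rewrite ?nnegrE ?powR_ge0//; first by nra.
  have := @powR_bernoulli_lt R p 2 p1 two0; rewrite (_ : 2 != 1 :> R); last lra.
  by move=> /(_ isT) h; apply: le_lt_trans (h _); nra.
have h12 : (2^-1 : R) <= 1 by lra.
pose H := fun t : R => (1 + t / p) `^ p +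
    (p + 1)^-1 * ((p + 1) / p * (2 - (1 + p * t) `^ p^-1)) `^ p.
have cH (t : R) : 2^-1 <= t <= 1 -> {for t, continuous H}.
  move=> /andP[t2 t1].
  have hi2 : (1 + p * t) `^ p^-1 < 2 by apply: hi; lra.
  have c1 : {for t, continuous (fun t : R => (1 + t / p) `^ p)}.
    apply: continuous_powR_comp; first by rewrite addr_gt0// divr_gt0//; lra.
    rewrite (_ : (fun _ => _) = (fun t => 1 + p^-1 * t)).
      exact: continuous_affine.
    by apply/funext => z; rewrite mulrC.
  have c2 : {for t, continuous (fun t : R => (1 + p * t) `^ p^-1)}.
    by apply: continuous_powR_comp; [nra | exact: continuous_affine].
  have c3 : {for t, continuous
      (fun t : R => (p + 1) / p * (2 - (1 + p * t) `^ p^-1))}.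
    by apply: cvgM; [exact: cvg_cst | apply: cvgB; [exact: cvg_cst | exact: c2]].
  have c4 : {for t, continuous
      (fun t : R => ((p + 1) / p * (2 - (1 + p * t) `^ p^-1)) `^ p)}.
    by apply: continuous_powR_comp => //; rewrite mulr_gt0 ?divr_gt0//; lra.
  by apply: cvgD; [exact: c1 | apply: cvgM; [exact: cvg_cst | exact: c4]].
(* At [t = 1] the first power alone is at least 2, by Bernoulli. *)
have H1 : 2 <= H 1.
  rewrite /H; have : 2 <= (1 + 1 / p) `^ p.
    have := @powR_bernoulli R p (1 + 1 / p) p1.
    rewrite (_ : 1 + p * _ = 2); last by field; lra.
    by apply; rewrite addr_gt0// divr_gt0.
  have : 0 <= (p + 1)^-1 * ((p + 1) / p * (2 - (1 + p * 1) `^ p^-1)) `^ p.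
    by rewrite mulr_ge0 ?powR_ge0// invr_ge0; lra.
  by lra.
(* At [t = 1/2] the first power is at most [(2 * p + 1) / (p + 1)], by Bernoulli at the reciprocal,
   and the second is at most 1. The weighted sum of these bounds is exactly 2. *)
have H2 : H 2^-1 <= 2.
  rewrite /H.
  have h1 : (1 + 2^-1 / p) `^ p <= (2 * p + 1) / (p + 1).
    set s := 1 + 2^-1 / p.
    have s0 : 0 < s by rewrite addr_gt0// divr_gt0// invr_gt0.
    have sE : s = (2 * p + 1) / (2 * p) by rewrite /s; field; lra.
    have sV : 1 + p * (s^-1 - 1) = (p + 1) / (2 * p + 1).
      by rewrite sE; field; lra.
    have sV0 : 0 < s^-1 by rewrite invr_gt0.
    have := powR_bernoulli p1 sV0; rewrite sV.
    rewrite powRV ?(ltW s0)//.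
    rewrite -[X in X <= _ -> _]invf_div lef_pV2// posrE ?powR_gt0//.
    by rewrite divr_gt0; lra.
  have h2 : ((p + 1) / p * (2 - (1 + p * 2^-1) `^ p^-1)) `^ p <= 1.
    have lo2 := lo _ (lexx _).
    have hi2 : (1 + p * 2^-1) `^ p^-1 < 2 by apply: hi; lra.
    rewrite -[leRHS](congr1 (@^~ p) (@powR1 R)).
    apply: ge0_ler_powR; rewrite ?nnegrE//; first exact: ltW.
      by rewrite mulr_ge0// ?divr_ge0//; lra.
    have E1 : 1 = (p + 1) / p * (2 - (p + 2) / (p + 1)) by field; lra.
    by rewrite [leRHS]E1 ler_pM2l ?divr_gt0//; lra.
  have p10 : 0 < (p + 1)^-1 by rewrite invr_gt0; lra.
  have := ler_wpM2l (ltW p10) h2.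
  have : (2 * p + 1) / (p + 1) + (p + 1)^-1 * 1 = 2 by field; lra.
  by lra.
have wH : {within `[2^-1, 1], continuous H}.
  by apply: continuous_in_subspaceT => t; rewrite inE/= in_itv/=; exact: cH.
have HE t : H t = (1 + t / p) `^ p +
    (p + 1)^-1 * ((p + 1) / p * (2 - (1 + p * t) `^ p^-1)) `^ p by [].
clearbody H.
have [|t] := @IVT R H 2^-1 1 2 h12 wH.
  by rewrite ge_min le_max H1 H2 orbT.
rewrite in_itv/= HE => /andP[t2 t1] Ht; exists t; split => //; first exact/andP.
by rewrite lo ?hi ?t1 ?andbT ?(le_trans _ t2)// invr_ge0.
Qed.

(** * Integrals of piecewise power functions *)

Section pieces.
Variable R : realType.
Local Notation mu := (@lebesgue_measure R).

(** An antiderivative of [k * t^e + l * t^g]. Two powers suffice: pieces of the first class have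
    exponents 0 and [a], or [a] and [2 * a] under the kernel; for the second class [a] is replaced
    by [- (1 + a)]. *)
Definition prim_powers (k e l g t : R) : R :=
  k * t `^ (1 + e) / (1 + e) + l * t `^ (1 + g) / (1 + g).

Lemma is_derive_prim_powers (k e l g t : R) : 0 < t -> 1 + e != 0 -> 1 + g != 0 ->
  is_derive t 1 (prim_powers k e l g) (k * t `^ e + l * t `^ g).
Proof.
move=> t0 e1 g1.
have he := is_derive1_powR (1 + e) t0; have hg := is_derive1_powR (1 + g) t0.
rewrite (_ : prim_powers k e l g = (k / (1 + e)) *: (fun t => t `^ (1 + e))
  + (l / (1 + g)) *: (fun t => t `^ (1 + g))); last first.
  by apply/funext => s; rewrite /prim_powers/= !fctE /GRing.scale/=; ring.
apply: is_derive_eq; rewrite /GRing.scale/= !(addrC 1) !addrK.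
by field; rewrite !(addrC _ 1) e1 g1.
Qed.

Lemma integral_powers (k e l g u v : R) (h : R -> R) :
  0 < u <= v -> 1 + e != 0 -> 1 + g != 0 ->
  (forall s, u <= s <= v -> h s = k * s `^ e + l * s `^ g) ->
  mu.-integrable `[u, v] (EFin \o h) /\
  \int[mu]_(s in `[u, v]) h s = prim_powers k e l g v - prim_powers k e l g u.
Proof.
move=> /andP[u0 uv] e1 g1 hE.
pose h' s := k * s `^ e + l * s `^ g.
have ch' s : 0 < s -> {for s, continuous h'}.
  move=> s0; apply: cvgD; apply: cvgM; try exact: cvg_cst;
    exact: continuous_powRr.
have wh' : {within `[u, v], continuous h'}.
  apply: continuous_in_subspaceT => s; rewrite inE/= in_itv/= => /andP[us _].
  by apply: ch'; lra.
have ih' : mu.-integrable `[u, v] (EFin \o h').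
  by apply: continuous_compact_integrable => //; exact: segment_compact.
have hh' s : s \in `[u, v] -> h s = h' s by rewrite in_itv/= => /hE.
split.
  apply: eq_integrable ih' => //= s; rewrite inE/= => sI.
  by rewrite hh'.
rewrite (@eq_Rintegral _ _ _ mu `[u, v] h'); last first.
  by move=> s; rewrite inE/= => sI; rewrite hh'.
(* Clamped endpoints can reduce the interval to a point; the fundamental theorem of calculus is kept
   for [u < v]. *)
move: uv; rewrite le_eqVlt => /predU1P[->|uv].
  by rewrite set_itv1 Rintegral_set1 subrr.
have dp (s : R) : 0 < s -> is_derive s 1 (prim_powers k e l g) (h' s).
  by move=> s0; exact: is_derive_prim_powers.
rewrite /Rintegral (@continuous_FTC2 _ h' (prim_powers k e l g))//.
  split => [s||]; rewrite ?in_itv/=.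
  - by move=> /andP[us _]; have [] := dp s (lt_trans u0 us).
  - apply: cvg_at_right_filter; apply: differentiable_continuous.
    by apply/derivable1_diffP; have [] := dp _ u0.
  - apply: cvg_at_left_filter; apply: differentiable_continuous.
    by apply/derivable1_diffP; have [] := dp _ (lt_trans u0 uv).
move=> s; rewrite in_itv/= => /andP[us _]; rewrite derive1E.
by apply: derive_val; apply: dp; lra.
Qed.

(** The indicator cuts [A] down to an interval with endpoints [w] and [w']. Its brackets are left
    free because endpoints carry no mass: every case reduces to the open interval. *)
Lemma integral_indic_itv (k e l g u v w w' : R) (b b' : bool) (h : R -> R)
    (A : set R) : measurable A ->
  0 < w <= w' -> 1 + e != 0 -> 1 + g != 0 ->
  (forall s, w <= s <= w' -> h s = k * s `^ e + l * s `^ g) ->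
  A `&` `]u, v] = [set` Interval (BSide b w) (BSide b' w')] ->
  mu.-integrable A (EFin \o (fun s => h s * \1_(`]u, v]) s)) /\
  \int[mu]_(s in A) (h s * \1_(`]u, v]) s) =
    prim_powers k e l g w' - prim_powers k e l g w.
Proof.
move=> mA ww' e1 g1 hE AI.
have [ih Ih] := integral_powers ww' e1 g1 hE.
have hp : (fun s => h s * \1_(`]u, v]) s) = h \_ `]u, v].
  apply/funext => s; rewrite indicE patchE.
  by case: ifP => _; rewrite ?mulr1 ?mulr0.
have sub : [set` Interval (BSide b w) (BSide b' w')] `<=` `[w, w'].
  by apply: subset_itvScc; [case: b {AI}|case: b' {AI}]; rewrite bnd_simp.
have mI : measurable [set` Interval (BSide b w) (BSide b' w')] by [].
split.
  rewrite hp.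
  apply: (proj2 (@integrable_mkcond _ _ R mu A (EFin \o (h \_ `]u, v])) mA)).
  rewrite [X in mu.-integrable _ X](_ : _ =
    (EFin \o h) \_ (A `&` `]u, v])); last first.
    apply/funext => s; rewrite !patchE/= patchE in_setI.
    by case: ifP => //=; case: ifP.
  rewrite AI; apply: (proj1 (@integrable_mkcond _ _ R mu _ (EFin \o h) mI)).
  by apply: (@integrableS _ _ R mu _ _ _ _ mI sub ih).
rewrite hp -Rintegral_mkcondr AI -Ih.
have mh : measurable_fun `]w, w'[ h.
  apply/measurable_EFinP.
  have sub' : `]w, w'[ `<=` `[w, w'] by apply: subset_itvScc; rewrite bnd_simp.
  apply: (measurable_int mu); exact: (@integrableS _ _ R mu _ _ _ _ _ sub' ih).
have {}mh : measurable_fun `]w, w'[ (EFin \o h) by exact/measurable_EFinP.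
rewrite /Rintegral (@integral_itv_bndoo R w w' (EFin \o h) b b')//.
by rewrite (@integral_itv_bndoo R w w' (EFin \o h) true false).
Qed.

Lemma indic_itvoc (u v t : R) : \1_(`]u, v]) t = (u < t <= v)%R%:R :> R.
Proof. by rewrite indicE mem_setE in_itv. Qed.

(** The clamped point [max u (min t v)] covers at once [t] before, inside and after the piece. *)
Lemma integral_powers_below (k e l g u v t : R) (h : R -> R) : 0 < u <= v ->
  1 + e != 0 -> 1 + g != 0 ->
  (forall s, u <= s <= v -> h s = k * s `^ e + l * s `^ g) ->
  mu.-integrable `[0, t] (EFin \o (fun s => h s * \1_(`]u, v]) s)) /\
  \int[mu]_(s in `[0, t]) (h s * \1_(`]u, v]) s) =
    prim_powers k e l g (Num.max u (Num.min t v)) - prim_powers k e l g u.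
Proof.
move=> /andP[u0 uv] e1 g1 hE.
have uw : u <= Num.max u (Num.min t v) by rewrite le_max lexx.
have wv : Num.max u (Num.min t v) <= v by rewrite ge_max uv ge_min lexx orbT.
apply: (@integral_indic_itv k e l g u v u _ false false) => //.
- by rewrite u0.
- by move=> s /andP[us sw]; apply: hE; rewrite us (le_trans sw).
- apply/seteqP; split => s /=; rewrite !in_itv/= le_max le_min.
    by move=> [/andP[_ ->] /andP[-> ->]]; rewrite orbT.
  move=> /andP[us]; rewrite leNgt us/= => /andP[-> ->].
  by rewrite (ltW (lt_trans u0 us)).
Qed.

Lemma integral_powers_above (k e l g u v t : R) (h : R -> R) : 0 < u <= v ->
  1 + e != 0 -> 1 + g != 0 ->
  (forall s, u <= s <= v -> h s = k * s `^ e + l * s `^ g) ->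
  mu.-integrable `[t, +oo[ (EFin \o (fun s => h s * \1_(`]u, v]) s)) /\
  \int[mu]_(s in `[t, +oo[) (h s * \1_(`]u, v]) s) =
    prim_powers k e l g v - prim_powers k e l g (Num.max u (Num.min t v)).
Proof.
move=> /andP[u0 uv] e1 g1 hE.
set w := Num.max u _.
have uw : u <= w by rewrite le_max lexx.
have wv : w <= v by rewrite ge_max uv ge_min lexx orbT.
(* The left bracket is closed exactly when [t] cuts the piece. For [t <= u] the whole []u, v]]
   remains, and for [v < t] the empty []v, v]]. *)
apply: (@integral_indic_itv k e l g u v w v (u < t <= v) false) => //.
- by rewrite (lt_le_trans u0 uw).
- by move=> s /andP[ws sv]; apply: hE; rewrite sv (le_trans uw).
rewrite /w; have [ut|tu] := ltP u t; last first.
  have -> : Num.max u (Num.min t v) = u by apply/max_idPl; rewrite ge_min tu.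
  apply/seteqP; split => s /=; rewrite !in_itv/= andbT; first by case.
  by move=> /andP[us sv]; rewrite us sv (le_trans tu (ltW us)).
have [tv|vt] := leP t v.
  have -> : Num.max u t = t by apply/max_idPr/ltW.
  apply/seteqP; split => s /=; rewrite !in_itv/= andbT.
    by move=> [-> /andP[_ ->]].
  by move=> /andP[ts ->]; rewrite ts (lt_le_trans ut ts).
have -> : Num.max u v = v by apply/max_idPr.
apply/seteqP; split => s /=; rewrite !in_itv/= andbT.
  by move=> [ts /andP[_ sv]]; have := lt_le_trans vt (le_trans ts sv); rewrite ltxx.
by move=> /andP[vs sv]; have := lt_le_trans vs sv; rewrite ltxx.
Qed.

Lemma integral_powers_below2 (k e l g k' l' u v w t : R) (h h' f : R -> R) :
  0 < u < v -> v < w -> 1 + e != 0 -> 1 + g != 0 ->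
  (forall s, 0 < s -> h s = k * s `^ e + l * s `^ g) ->
  (forall s, 0 < s -> h' s = k' * s `^ e + l' * s `^ g) ->
  (forall s, 0 <= s -> f s = h s * \1_(`]u, v]) s + h' s * \1_(`]v, w]) s) ->
  \int[mu]_(s in `[0, t]) f s =
    (prim_powers k e l g (Num.max u (Num.min t v)) - prim_powers k e l g u) +
    (prim_powers k' e l' g (Num.max v (Num.min t w)) - prim_powers k' e l' g v).
Proof.
move=> /andP[u0 uv] vw e1 g1 hE hE' fE.
have uv' : 0 < u <= v by rewrite u0 ltW.
have vw' : 0 < v <= w by rewrite (lt_trans u0 uv) ltW.
have [s /andP[us _]|i1 I1] := @integral_powers_below k e l g u v t h uv' e1 g1.
  by apply: hE; exact: lt_le_trans us.
have [s /andP[vs _]|i2 I2] := @integral_powers_below k' e l' g v w t h' vw' e1 g1.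
  by apply: hE'; exact: lt_le_trans (lt_trans u0 uv) vs.
rewrite -I1 -I2 -RintegralD//; apply: eq_Rintegral => s.
by rewrite inE/= in_itv/= => /andP[s0 _]; exact: fE.
Qed.

Lemma integral_powers_above2 (k e l g k' l' u v w t : R) (h h' f : R -> R) : 0 <= t ->
  0 < u < v -> v < w -> 1 + e != 0 -> 1 + g != 0 ->
  (forall s, 0 < s -> h s = k * s `^ e + l * s `^ g) ->
  (forall s, 0 < s -> h' s = k' * s `^ e + l' * s `^ g) ->
  (forall s, 0 <= s -> f s = h s * \1_(`]u, v]) s + h' s * \1_(`]v, w]) s) ->
  \int[mu]_(s in `[t, +oo[) f s =
    (prim_powers k e l g v - prim_powers k e l g (Num.max u (Num.min t v))) +
    (prim_powers k' e l' g w - prim_powers k' e l' g (Num.max v (Num.min t w))).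
Proof.
move=> t0 /andP[u0 uv] vw e1 g1 hE hE' fE.
have uv' : 0 < u <= v by rewrite u0 ltW.
have vw' : 0 < v <= w by rewrite (lt_trans u0 uv) ltW.
have [s /andP[us _]|i1 I1] := @integral_powers_above k e l g u v t h uv' e1 g1.
  by apply: hE; exact: lt_le_trans us.
have [s /andP[vs _]|i2 I2] := @integral_powers_above k' e l' g v w t h' vw' e1 g1.
  by apply: hE'; exact: lt_le_trans (lt_trans u0 uv) vs.
rewrite -I1 -I2 -RintegralD//; apply: eq_Rintegral => s.
by rewrite inE/= in_itv/= andbT => ts; apply: fE; exact: le_trans ts.
Qed.

(** Two formulas, one of which changes sign, give three pieces for the absolute value. The norm is
    the tail integral from 0, where each clamped point is the left end of its piece. *)
Lemma L1norm_pieces (e g u0 u1 u2 u3 k1 l1 k2 l2 k3 l3 : R) (h1 h2 h3 f : R -> R) :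
  0 < u0 <= u1 -> u1 <= u2 <= u3 -> 1 + e != 0 -> 1 + g != 0 ->
  (forall s, 0 < s -> h1 s = k1 * s `^ e + l1 * s `^ g) ->
  (forall s, 0 < s -> h2 s = k2 * s `^ e + l2 * s `^ g) ->
  (forall s, 0 < s -> h3 s = k3 * s `^ e + l3 * s `^ g) ->
  (forall s, 0 <= s -> `|f s| = h1 s * \1_(`]u0, u1]) s +
    (h2 s * \1_(`]u1, u2]) s + h3 s * \1_(`]u2, u3]) s)) ->
  L1norm f = ((prim_powers k1 e l1 g u1 - prim_powers k1 e l1 g u0) +
    ((prim_powers k2 e l2 g u2 - prim_powers k2 e l2 g u1) +
     (prim_powers k3 e l3 g u3 - prim_powers k3 e l3 g u2)))%:E.
Proof.
move=> /andP[u00 u01] /andP[u12 u23] e1 g1 E1 E2 E3 fE.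
have u10 := lt_le_trans u00 u01; have u20 := lt_le_trans u10 u12.
have U1 : 0 < u0 <= u1 by rewrite u00.
have U2 : 0 < u1 <= u2 by rewrite u10.
have U3 : 0 < u2 <= u3 by rewrite u20.
have [s /andP[us _]|i1 I1] := @integral_powers_above k1 e l1 g u0 u1 0 h1 U1 e1 g1.
  by apply: E1; exact: lt_le_trans us.
have [s /andP[us _]|i2 I2] := @integral_powers_above k2 e l2 g u1 u2 0 h2 U2 e1 g1.
  by apply: E2; exact: lt_le_trans us.
have [s /andP[us _]|i3 I3] := @integral_powers_above k3 e l3 g u2 u3 0 h3 U3 e1 g1.
  by apply: E3; exact: lt_le_trans us.
have clamp0 (u v : R) : 0 < u <= v -> Num.max u (Num.min 0 v) = u.
  by move=> /andP[u_gt0 _]; apply/max_idPl; rewrite ge_min ltW.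
rewrite !clamp0// in I1 I2 I3.
rewrite -I1 -I2 -I3 /L1norm.
rewrite /Rintegral EFinD EFinD !fineK ?integrable_fin_num//.
rewrite -integralD// -?integralD//; last exact: integrableD.
apply: eq_integral => s; rewrite inE/= in_itv/= andbT => s0.
by rewrite fE.
Qed.
End pieces.

(** * The stationarity equations *)

Section stationarity.
Variable R : realType.

Lemma powR1D (t e : R) : 0 < t -> t `^ (1 + e) = t * t `^ e.
Proof. by move=> t0; rewrite powRD ?(powRr1 (ltW t0))// (gt_eqF t0) implybT. Qed.

Lemma powRDD (t e : R) : 0 < t -> t `^ (e + e) = t `^ e * t `^ e.
Proof. by move=> t0; rewrite powRD// (gt_eqF t0) implybT. Qed.

Lemma one_powR (e : R) : 1 `^ e = 1.
Proof. by rewrite powR1. Qed.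

Lemma powR_lt (x y e : R) : 0 < e -> 0 <= x -> x < y -> x `^ e < y `^ e.
Proof.
move=> e0 x0 xy; have y0 := le_trans x0 (ltW xy).
by apply: gt0_ltr_powR.
Qed.

Lemma powR_le (x y e : R) : 0 < e -> 0 <= x -> x <= y -> x `^ e <= y `^ e.
Proof.
move=> e0 x0 xy; have y0 := le_trans x0 xy.
by apply: ge0_ler_powR; rewrite ?nnegrE// ltW.
Qed.

Lemma lt_powR_inv (x y e : R) : 0 < e -> 0 <= y -> x `^ e < y `^ e -> x < y.
Proof.
move=> e0 y0; rewrite !ltNge; apply: contra; exact: powR_le.
Qed.

(* At the extremal member of the first class [x = d / c], [y = b] and
   [r = b / c]; at that of the second one [x = 1 / b], [y = c / d] and
   [r = c / b]. *)
Definition optimal_parameters (a theta x y r : R) : Prop :=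
  [/\ 0 < theta < 2, [/\ 1 < x, 1 < y & 0 < r < 1],
   x `^ a = 1 + theta * a / (1 + a) /\ y * y `^ a = 1 + theta * (1 + a) / a,
   y `^ a = 2 - (1 + a) / (1 + 2 * a) * r `^ a &
   x * x `^ a = 2 - a / (1 + 2 * a) * (r * r `^ a)].

(** All equations but the last are solved by explicit roots, with [theta] as parameter; the last one
    is then the equation of [exists_stationary_theta]. *)
Lemma exists_optimal_parameters (a : R) : 0 < a ->
  exists theta x y r : R, optimal_parameters a theta x y r.
Proof.
move=> a0; pose p := (1 + a) / a.
have pE : p = a^-1 + 1 by rewrite /p; field; lra.
have p1 : 1 < p by rewrite pE ltrDr invr_gt0.
have p0 : 0 < p by lra.
have [t [/andP[t_ge t_le] /andP[loB hiB] Ht]] := exists_stationary_theta p1.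
(* [B] will be [y^a] and [C] will be [r^a]. *)
pose B := (1 + p * t) `^ p^-1; pose C := (p + 1) / p * (2 - B).
have A0 : 1 < 1 + t / p by rewrite ltrDl divr_gt0//; lra.
have B0 : 1 < 1 + p * t by rewrite ltrDl mulr_gt0//; lra.
have B2 : (p + 2) / (p + 1) < B by [].
have C0 : 0 < C by rewrite mulr_gt0 ?divr_gt0 ?subr_gt0//; lra.
have C1 : C < 1.
  have -> : 1 = (p + 1) / p * (2 - (p + 2) / (p + 1)) by field; lra.
  by rewrite ltr_pM2l ?divr_gt0//; lra.
have aV0 : 0 < a^-1 by rewrite invr_gt0.
have a10 : 0 < (1 + a)^-1 by rewrite invr_gt0; lra.
have rootK (z : R) : 0 < z -> (z `^ a^-1) `^ a = z.
  by move=> z0; rewrite -powRrM mulVf ?gt_eqF// powRr1// ltW.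
have rootM (z : R) : 0 < z -> z `^ a^-1 * z = z `^ p.
  by move=> z0; rewrite pE addrC powR1D// mulrC.
exists t, ((1 + t / p) `^ a^-1), ((1 + p * t) `^ (1 + a)^-1), (C `^ a^-1).
have y0 : 0 < (1 + p * t) `^ (1 + a)^-1 by apply: powR_gt0; lra.
have gt1 (z e : R) : 0 < e -> 1 < z -> 1 < z `^ e.
  move=> e0 z1; have := powR_lt e0 ler01 z1.
  by rewrite one_powR.
have yB : ((1 + p * t) `^ (1 + a)^-1) `^ a = B.
  by rewrite -powRrM /B /p invf_div [_^-1 * a]mulrC.
have A0' : 0 < 1 + t / p by lra.
have B0' : 0 < 1 + p * t by lra.
split.
- by lra.
- split; [exact: gt1 | exact: gt1 | rewrite powR_gt0//=].
  by have := powR_lt aV0 (ltW C0) C1; rewrite one_powR.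
- rewrite rootK//; split; first by rewrite /p; field; lra.
  rewrite -powR1D// -powRrM mulVf ?powRr1 ?ltW//; last by lra.
  by rewrite /p; field; lra.
- rewrite yB rootK// /C /p; field; lra.
- rewrite !rootK// !rootM//.
  have -> : a / (1 + 2 * a) = (p + 1)^-1 by rewrite /p; field; lra.
  by rewrite -Ht /C /B; ring.
Qed.

(** The letters [B], [C], [X] stand for [b^a], [c^a], [d^a], then [Xa], [Ya], [Ra] for [x^a], [y^a],
    [r^a], and [M] for [r^(1+a)], while [x^(1+a)] and [y^(1+a)] are replaced by their stationary
    values. The left side is the norm, the relation on [C] says that [c] is the zero, and the rest
    is a rational identity. *)
Lemma slack_identity (a theta b c d B C X Xa Ya Ra M : R) : a != 0 ->
  1 + a != 0 -> 1 + 2 * a != 0 -> B != 0 -> C != 0 ->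
  (1 + 2 * a) / a * (2 / B - 1) * C = (1 + a) / a ->
  Xa = 1 + theta * a / (1 + a) ->
  Ya = 2 - (1 + a) / (1 + 2 * a) * Ra ->
  a / (1 + a) * (1 - 2 * b) + 2 * c - (1 + a) / a * d + d / a * (X / C) =
  theta * (d - 1) +
   (d * (X / C) + a * (2 - a / (1 + 2 * a) * M) * c - (1 + a) * (Xa * d)) / a +
   ((1 + a) / (1 + 2 * a) * (c * (a * M) + b * (B / C) - (1 + a) * (Ra * b)) +
     (a * (1 + theta * (1 + a) / a) + b * B - (1 + a) * (Ya * b))) / (1 + a).
Proof.
move=> a0 a1 a2 B0 C0 HC -> ->.
(* The relation defining the zero is linear in [B^-1]; it is solved for [B], which can then be
   eliminated. *)
have K : 2 * C = B * (C + (1 + a) / (1 + 2 * a)).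
  have -> : B * (C + (1 + a) / (1 + 2 * a)) =
     B * (C + a / (1 + 2 * a) * ((1 + a) / a)) by field; rewrite a0 a2.
  by rewrite -HC; field; rewrite a0 a2 B0.
have N0 : C + (1 + a) / (1 + 2 * a) != 0.
  apply/eqP => E; move: K; rewrite E mulr0 => /eqP.
  by rewrite mulf_eq0 (negPf C0) pnatr_eq0.
have N1 : C * (1 + 2 * a) + (1 + a) != 0.
  have -> : C * (1 + 2 * a) + (1 + a) = (C + (1 + a) / (1 + 2 * a)) * (1 + 2 * a).
    by field.
  by rewrite mulf_neq0.
have BE : B = 2 * C * (1 + 2 * a) / (C * (1 + 2 * a) + (1 + a)).
  apply: (mulIf N0); rewrite -K; field; rewrite a2 N1//.
by rewrite BE; field; rewrite a0 a1 a2 C0 N1.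
Qed.

End stationarity.

(** The letters are those of [slack_identity], but the Young pairs are now [y] with [c / d], [x]
    with [1 / b], and [r] with [c / b]. *)
Lemma slack_identity_star (R : realType) (a theta b c d B C X Xa Ya Ra M : R) :
  a != 0 -> 1 + a != 0 -> 1 + 2 * a != 0 -> b != 0 -> B != 0 ->
  (1 + 2 * a) / (1 + a) * (2 * (b * B) - 1) = a / (1 + a) * (c * C) ->
  Xa = 1 + theta * a / (1 + a) ->
  Ya = 2 - (1 + a) / (1 + 2 * a) * Ra ->
  a / (1 + a) * d - 2 * c + (1 + a) / a * (2 * b - 1) + c * (C / X) / (1 + a) =
  theta * (1 - d) +
   (a * (1 + theta * (1 + a) / a) * d + c * (C / X) - (1 + a) * (Ya * c))
     / (1 + a) +
   ((a * (2 - a / (1 + 2 * a) * M) * b + B^-1 - (1 + a) * Xa) +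
    a / (1 + 2 * a) * (a * M * b + c * (C / B) - (1 + a) * (Ra * c))) / a.
Proof.
move=> a0 a1 a2 b0 B0 HD -> ->.
have K : 1 + a / (1 + 2 * a) * (c * C) = 2 * (b * B).
  have -> : a / (1 + 2 * a) * (c * C) =
     (1 + a) / (1 + 2 * a) * (a / (1 + a) * (c * C)) by field; rewrite a1 a2.
  by rewrite -HD; field; rewrite a1 a2.
have KB : B^-1 * (1 + a / (1 + 2 * a) * (c * C)) = 2 * b.
  by rewrite K; field.
(* The two terms containing [B^-1] are grouped so that [KB] replaces them by [2 * b]. *)
have -> : (a * (2 - a / (1 + 2 * a) * M) * b + B^-1
      - (1 + a) * (1 + theta * a / (1 + a))) +
    a / (1 + 2 * a) * (a * M * b + c * (C / B) - (1 + a) * (Ra * c)) =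
    a * (2 - a / (1 + 2 * a) * M) * b
    + B^-1 * (1 + a / (1 + 2 * a) * (c * C)) - (1 + a) * (1 + theta * a / (1 + a)) +
    a / (1 + 2 * a) * (a * M * b - (1 + a) * (Ra * c)) by ring.
rewrite KB; move: (C / X) => CX.
by field; rewrite a0 a1 a2.
Qed.

(** * Norms and level sets *)

Section class.
Variable R : realType.
Local Notation mu := (@lebesgue_measure R).

(** The zero [c] is where the second formula changes sign. The two relations on [D] eliminate it,
    and the only powers left occur in the ratio [d^a / c^a]. *)
Lemma Fclass_L1norm (a b c d D : R) (f : R -> R) : 0 < a ->
  1 < b -> b < c -> c < d ->
  D = (1 + 2 * a) / a * (2 * b `^ (- a) - 1) -> D * c `^ a = (1 + a) / a ->
  (forall t, 0 <= t -> f t =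
    ((1 + a) / a - (1 + 2 * a) / a * t `^ a) * \1_(`]1, b]) t +
    (- ((1 + a) / a) + D * t `^ a) * \1_(`]b, d]) t) ->
  L1norm f = (a / (1 + a) * (1 - 2 * b) + 2 * c - (1 + a) / a * d +
    d / a * (d `^ a / c `^ a))%:E.
Proof.
move=> a0 b1 bc cd DE Dc fE.
have c0 : 0 < c by lra. have b0 : 0 < b by lra. have d0 : 0 < d by lra.
have p0 : 0 < (1 + a) / a by rewrite divr_gt0//; lra.
have q0 : (1 + 2 * a) / a = (1 + a) / a + 1 by field; lra.
have C0 : 0 < c `^ a by rewrite powR_gt0.
have B0 : 0 < b `^ a by rewrite powR_gt0.
have D0 : 0 < D by rewrite -(pmulr_lgt0 _ C0) Dc.
have e0 : 1 + 0 != 0 :> R by rewrite addr0 oner_eq0.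
have ea : 1 + a != 0 by rewrite gt_eqF//; lra.
rewrite (@L1norm_pieces R 0 a 1 b c d (- ((1 + a) / a)) ((1 + 2 * a) / a)
  ((1 + a) / a) (- D) (- ((1 + a) / a)) D
  (fun t => - ((1 + a) / a) + (1 + 2 * a) / a * t `^ a)
  (fun t => (1 + a) / a - D * t `^ a)
  (fun t => - ((1 + a) / a) + D * t `^ a))//.
- congr (_%:E); rewrite /prim_powers !addr0 !powRr1 ?ltW// !powR1D// one_powR.
  have E1 : D * (b * b `^ a) = b * ((1 + 2 * a) / a) * (2 - b `^ a).
    by rewrite DE powRN; field; rewrite (gt_eqF a0) gt_eqF.
  have E2 : D * (c * c `^ a) = c * ((1 + a) / a) by rewrite -Dc; ring.
  have E3 : D * (d * d `^ a) = d * ((1 + a) / a) * (d `^ a / c `^ a).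
    by rewrite -Dc; field; rewrite gt_eqF.
  rewrite !mulNr E1 E2 E3; move: (d `^ a / c `^ a) (b `^ a) => X B.
  by field; rewrite ea gt_eqF.
- by rewrite ltr01 ltW.
- by rewrite !ltW.
- by move=> s s0; rewrite powRr0 mulr1.
- by move=> s s0; rewrite powRr0 mulr1 mulNr.
- by move=> s s0; rewrite powRr0 mulr1.
move=> s s0; rewrite fE// !indic_itvoc.
have [s1|s1] := leP s 1.
  have -> : (b < s) = false by lra.
  have -> : (c < s) = false by lra.
  by rewrite /= !mulr0 !addr0 normr0.
have [sb|sb] /= := leP s b.
  have -> : (c < s) = false by lra.
  (* On the first piece [f] equals [-1 - ((1 + a) / a + 1) * (s^a - 1)], hence is negative. *)
  have S1 : 1 <= s `^ a.
    by have := powR_le a0 ler01 (ltW s1); rewrite one_powR.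
  rewrite /= !mulr0 !addr0 !mulr1 q0 ler0_norm; first by ring.
  have : 0 <= ((1 + a) / a + 1) * (s `^ a - 1) by rewrite mulr_ge0; lra.
  by lra.
have [sc|sc] /= := leP s c.
  have -> : (s <= d) = true by lra.
  have S1 : D * s `^ a <= D * c `^ a.
    by rewrite ler_pM2l// powR_le// ltW.
  rewrite /= !mulr0 !add0r !addr0 !mulr1 ler0_norm; first by ring.
  by move: S1; rewrite Dc; lra.
have S1 : D * c `^ a <= D * s `^ a by rewrite ler_pM2l// powR_le// ltW.
rewrite !mulr0 !add0r; have [sd|sd] /= := leP s d; last by rewrite !mulr0 normr0.
by rewrite !mulr1 ger0_norm//; move: S1; rewrite Dc; lra.
Qed.

(** The operator takes the value 1 on []1, b]] and -1 on []b, d]]. Up to 1 everything vanishes;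
    beyond [d] its value is [(d / t)^(1+a)] times [f d - 1], of modulus below 1 because
    [0 < f d < 2]. *)
Lemma Fclass_level (a b d D : R) (f : R -> R) : 0 < a -> 1 < b -> b < d ->
  D = (1 + 2 * a) / a * (2 * b `^ (- a) - 1) ->
  0 < - ((1 + a) / a) + D * d `^ a < 2 ->
  (forall t, 0 <= t -> f t =
    ((1 + a) / a - (1 + 2 * a) / a * t `^ a) * \1_(`]1, b]) t +
    (- ((1 + a) / a) + D * t `^ a) * \1_(`]b, d]) t) ->
  [set t : R | 0 <= t /\ 1 <= `|(1 + 2 * a) / t `^ (1 + a) *
     \int[mu]_(s in `[0, t]) (f s * s `^ a) - f t| ] = `]1, d]%classic.
Proof.
move=> a0 b1 bd DE Dd fE.
have b0 : 0 < b by lra. have d0 : 0 < d by lra.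
have B0 : 0 < b `^ a by rewrite powR_gt0.
have ea : 1 + a != 0 by rewrite gt_eqF//; lra.
have ea2 : 1 + 2 * a != 0 by rewrite gt_eqF//; lra.
have eaa : 1 + (a + a) != 0 by rewrite gt_eqF//; lra.
have I (t : R) : \int[mu]_(s in `[0, t]) (f s * s `^ a) =
   (prim_powers ((1 + a) / a) a (- ((1 + 2 * a) / a)) (a + a)
       (Num.max 1 (Num.min t b))
     - prim_powers ((1 + a) / a) a (- ((1 + 2 * a) / a)) (a + a) 1) +
   (prim_powers (- ((1 + a) / a)) a D (a + a) (Num.max b (Num.min t d))
     - prim_powers (- ((1 + a) / a)) a D (a + a) b).
  apply: (@integral_powers_below2 R _ _ _ _ _ _ 1 b d t
    (fun t => ((1 + a) / a - (1 + 2 * a) / a * t `^ a) * t `^ a)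
    (fun t => (- ((1 + a) / a) + D * t `^ a) * t `^ a)) => //.
  - by rewrite ltr01.
  - by move=> s s0; rewrite powRDD//; ring.
  - by move=> s s0; rewrite powRDD//; ring.
  - by move=> s s0; rewrite fE//; ring.
have P1 k l s : 0 < s -> prim_powers k a l (a + a) s =
    s * s `^ a * (k / (1 + a) + l * s `^ a / (1 + 2 * a)).
  move=> s0; rewrite /prim_powers !powR1D// powRDD//.
  by field; rewrite ea ea2.
(* The value of [D] is the one for which the antiderivatives match at [b]; the first one vanishes at
   1, so no constant survives. *)
have J (t : R) : b <= t -> t <= d -> \int[mu]_(s in `[0, t]) (f s * s `^ a) =
    t * t `^ a * (- ((1 + a) / a) / (1 + a) + D * t `^ a / (1 + 2 * a)).
  move=> bt td; rewrite I (min_r bt) (min_l td) (max_r (ltW b1)) (max_r bt).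
  rewrite !P1 ?(lt_le_trans b0 bt)// DE powRN one_powR.
  by field; rewrite (gt_eqF a0) ea ea2 (gt_eqF B0).
apply/seteqP; split => t /=; rewrite in_itv/=; last first.
  move=> /andP[t1 td]; have t0 : 0 < t by lra.
  have T0 : 0 < t `^ a by rewrite powR_gt0.
  split; first exact: ltW.
  have [tb|bt] := leP t b.
    rewrite I fE ?(ltW t0)// !indic_itvoc.
    have -> : (b < t) = false by lra.
    rewrite t1 tb (min_l tb) (max_r (ltW t1)) (min_l td) (max_l tb) !P1// one_powR.
    rewrite powR1D// /= [X in `|X|](_ : _ = 1) ?normr1//.
    by field; rewrite (gt_eqF a0) ea ea2 (gt_eqF T0) (gt_eqF t0).
  rewrite J ?(ltW bt)// fE ?(ltW t0)// !indic_itvoc t1 bt td.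
  have -> : (t <= b) = false by lra.
  rewrite powR1D// /= [X in `|X|](_ : _ = -1) ?normrN1//.
  by field; rewrite (gt_eqF a0) ea ea2 (gt_eqF T0) (gt_eqF t0).
move=> [t0 H].
(* This case includes [t = 0]: the integral is 0 there, so the default value of the quotient is
   harmless. *)
have [t1|t1] := leP t 1.
  move: H; rewrite I fE// !indic_itvoc (min_l (le_trans t1 (ltW b1))) (max_l t1).
  have tb : t <= b by lra.
  rewrite (min_l (le_trans tb (ltW bd))) (max_l tb).
  rewrite !(ltNge _ t) t1 tb /= !subrr !mulr0 !addr0 mulr0 subr0 normr0.
  by rewrite ler10.
have t_gt0 : 0 < t by lra.
have [//|dt] := leP t d.
have bt : b < t by lra.
have It : \int[mu]_(s in `[0, t]) (f s * s `^ a) =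
    d * d `^ a * (- ((1 + a) / a) / (1 + a) + D * d `^ a / (1 + 2 * a)).
  rewrite -(J d (ltW bd) (lexx d)) !I (min_r (ltW bt)) (min_r (ltW dt)).
  by rewrite (min_r (ltW bd)) minxx.
have ft : f t = 0.
  rewrite fE// !indic_itvoc !(leNgt t) bt dt /= andbF.
  by rewrite !mulr0 addr0.
have T0 : 0 < t `^ a by rewrite powR_gt0.
have X0 : 0 < d `^ a by rewrite powR_gt0.
have w0 : 0 < d * d `^ a / (t * t `^ a) by rewrite divr_gt0// mulr_gt0.
have w1 : d * d `^ a / (t * t `^ a) < 1.
  rewrite ltr_pdivrMr ?mulr_gt0// mul1r.
  by rewrite ltr_pM ?ltW// powR_lt// ltW.
move: H; rewrite ft subr0 It powR1D// leNgt => /negP[].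
rewrite (_ : _ / _ * _ = d * d `^ a / (t * t `^ a) *
    (- ((1 + a) / a) + D * d `^ a - 1)); last first.
  by field; rewrite (gt_eqF a0) ea ea2 (gt_eqF T0) (gt_eqF t_gt0).
rewrite normrM gtr0_norm// -[ltRHS]mulr1 ltr_pM ?normr_ge0 ?ltW//.
by rewrite ltr_norml; lra.
Qed.
End class.

(** * Norm and level set for the dual class *)

Section class_star.
Variable R : realType.
Local Notation mu := (@lebesgue_measure R).

(** The negative exponent reverses the picture: [f] is positive on []d, c[], negative on []c, b]],
    and at most -1 on []b, 1]]. *)
Lemma Fclass_star_L1norm (a b c d D : R) (f : R -> R) : 0 < a ->
  0 < d -> d < c -> c < b -> b < 1 ->
  D = (1 + 2 * a) / (1 + a) * (2 * b `^ (1 + a) - 1) ->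
  D * c `^ (- (1 + a)) = a / (1 + a) ->
  (forall t, 0 <= t -> f t =
    (- (a / (1 + a)) + D * t `^ (- (1 + a))) * \1_(`]d, b]) t +
    (a / (1 + a) - (1 + 2 * a) / (1 + a) * t `^ (- (1 + a))) * \1_(`]b, 1]) t) ->
  L1norm f = (a / (1 + a) * d - 2 * c + (1 + a) / a * (2 * b - 1) +
    c * (c `^ a / d `^ a) / (1 + a))%:E.
Proof.
move=> a0 d0 dc cb b1 DE Dc fE.
have c0 : 0 < c by lra. have b0 : 0 < b by lra.
have a10 : 0 < 1 + a by lra.
have p0 : 0 < a / (1 + a) by rewrite divr_gt0//; lra.
have q0 : (1 + 2 * a) / (1 + a) = a / (1 + a) + 1 by field; lra.
have C0 : 0 < c `^ a by rewrite powR_gt0.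
have B0 : 0 < b `^ a by rewrite powR_gt0.
have X0 : 0 < d `^ a by rewrite powR_gt0.
have c1a0 : 0 < c `^ (- (1 + a)) by rewrite powR_gt0.
have D0 : 0 < D by rewrite -(pmulr_lgt0 _ c1a0) Dc.
have e0 : 1 + 0 != 0 :> R by rewrite addr0 oner_eq0.
have Na : 1 + - (1 + a) = - a by ring.
have ea : 1 + - (1 + a) != 0 by rewrite Na oppr_eq0 gt_eqF.
have anti (s t : R) : 0 < s -> s <= t -> t `^ (- (1 + a)) <= s `^ (- (1 + a)).
  move=> s0 st; have t0 : 0 < t by lra.
  by rewrite !powRN lef_pV2 ?posrE ?powR_gt0// powR_le// ltW.
rewrite (@L1norm_pieces R 0 (- (1 + a)) d c b 1 (- (a / (1 + a))) D
  (a / (1 + a)) (- D) (- (a / (1 + a))) ((1 + 2 * a) / (1 + a))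
  (fun t => - (a / (1 + a)) + D * t `^ (- (1 + a)))
  (fun t => a / (1 + a) - D * t `^ (- (1 + a)))
  (fun t => - (a / (1 + a)) + (1 + 2 * a) / (1 + a) * t `^ (- (1 + a))))//.
- congr (_%:E); rewrite /prim_powers !Na !addr0 !powRr1 ?ltW// !powRN one_powR.
  have DC : D = a / (1 + a) * (c * c `^ a).
    by rewrite -Dc powRN powR1D//; field; rewrite !gt_eqF.
  have E1 : D / b `^ a = (1 + 2 * a) / (1 + a) * (2 * b - (b `^ a)^-1).
    by rewrite DE powR1D//; field; rewrite !gt_eqF.
  have E2 : D / c `^ a = a / (1 + a) * c by rewrite DC; field; rewrite !gt_eqF.
  have E3 : D / d `^ a = a / (1 + a) * (c * (c `^ a / d `^ a)).
    by rewrite DC; field; rewrite !gt_eqF.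
  rewrite !mulNr E1 E2 E3; move: (c `^ a / d `^ a) (b `^ a)^-1 => X B.
  by field; rewrite !gt_eqF.
- by rewrite d0 ltW.
- by rewrite !ltW.
- by move=> s s0; rewrite powRr0 mulr1.
- by move=> s s0; rewrite powRr0 mulr1 mulNr.
- by move=> s s0; rewrite powRr0 mulr1.
move=> s s0; rewrite fE// !indic_itvoc.
have [sd|sd] := leP s d.
  have -> : (b < s) = false by lra.
  have -> : (c < s) = false by lra.
  by rewrite /= !mulr0 !addr0 normr0.
have s_gt0 : 0 < s by lra.
have [sc|sc] /= := leP s c.
  have -> : (s <= b) = true by lra.
  have -> : (b < s) = false by lra.
  have S1 : D * c `^ (- (1 + a)) <= D * s `^ (- (1 + a)).
    by rewrite ler_pM2l// anti.
  rewrite /= !mulr0 !addr0 !mulr1 ger0_norm//.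
  by move: S1; rewrite Dc; lra.
have [sb|sb] /= := leP s b.
  have S1 : D * s `^ (- (1 + a)) <= D * c `^ (- (1 + a)).
    by rewrite ler_pM2l// anti// ltW.
  rewrite !mulr0 !add0r !addr0 !mulr1 ler0_norm; first by ring.
  by move: S1; rewrite Dc; lra.
rewrite !mulr0 !add0r; have [s1|s1] /= := leP s 1; last by rewrite !mulr0 normr0.
have S1 : 1 <= s `^ (- (1 + a)).
  by have := anti s 1 s_gt0 s1; rewrite one_powR.
rewrite !mulr1 q0 ler0_norm; first by ring.
have : 0 <= (a / (1 + a) + 1) * (s `^ (- (1 + a)) - 1) by rewrite mulr_ge0; lra.
by lra.
Qed.

(** The operator is -1 on []d, b]], 1 on []b, 1]] and 0 beyond 1. Below [d] only the integral over
    the whole support remains; it gives [(t / d)^a] times [v - 1], where [v] is the right limit of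
    [f] at [d], strictly between 0 and 2. *)
Lemma Fclass_star_level (a b d D : R) (f : R -> R) : 0 < a ->
  0 < d -> d < b -> b < 1 ->
  D = (1 + 2 * a) / (1 + a) * (2 * b `^ (1 + a) - 1) ->
  0 < - (a / (1 + a)) + D * d `^ (- (1 + a)) < 2 ->
  (forall t, 0 <= t -> f t =
    (- (a / (1 + a)) + D * t `^ (- (1 + a))) * \1_(`]d, b]) t +
    (a / (1 + a) - (1 + 2 * a) / (1 + a) * t `^ (- (1 + a))) * \1_(`]b, 1]) t) ->
  [set t : R | 0 <= t /\ 1 <= `|(1 + 2 * a) * t `^ a *
     \int[mu]_(s in `[t, +oo[) (f s / s `^ (1 + a)) - f t| ] = `]d, 1]%classic.
Proof.
move=> a0 d0 db b1 DE Dd fE.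
have b0 : 0 < b by lra.
have B0 : 0 < b `^ a by rewrite powR_gt0.
have X0 : 0 < d `^ a by rewrite powR_gt0.
have a10 : 0 < 1 + a by lra.
have a20 : 0 < 1 + 2 * a by lra.
pose e := - (1 + a).
have ee : 1 + e = - a by rewrite /e; ring.
have ee2 : 1 + (e + e) = - (1 + (a + a)) by rewrite /e; ring.
have ea : 1 + e != 0 by rewrite ee oppr_eq0 gt_eqF.
have eaa : 1 + (e + e) != 0 by rewrite ee2 oppr_eq0 gt_eqF//; lra.
have I (t : R) : 0 <= t -> \int[mu]_(s in `[t, +oo[) (f s / s `^ (1 + a)) =
   (prim_powers (- (a / (1 + a))) e D (e + e) b -
     prim_powers (- (a / (1 + a))) e D (e + e) (Num.max d (Num.min t b))) +
   (prim_powers (a / (1 + a)) e (- ((1 + 2 * a) / (1 + a))) (e + e) 1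
     - prim_powers (a / (1 + a)) e (- ((1 + 2 * a) / (1 + a))) (e + e)
         (Num.max b (Num.min t 1))).
  move=> t0; apply: (@integral_powers_above2 R _ _ _ _ _ _ d b 1 t
    (fun t => (- (a / (1 + a)) + D * t `^ e) * t `^ e)
    (fun t => (a / (1 + a) - (1 + 2 * a) / (1 + a) * t `^ e) * t `^ e)) => //.
  - by rewrite d0.
  - by move=> s s0; rewrite powRDD//; ring.
  - by move=> s s0; rewrite powRDD//; ring.
  - by move=> s s0; rewrite fE// -powRN -/e; ring.
have P1 k l s : 0 < s -> prim_powers k e l (e + e) s =
    - (s `^ a)^-1 * (k / a + l / (s * s `^ a) / (1 + 2 * a)).
  move=> s0; rewrite /prim_powers ee ee2 !powRN powR1D// powRDD//.
  by field; rewrite !gt_eqF// powR_gt0.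
(* Again [D] makes the antiderivatives match at [b], and the one on []b, 1]] vanishes at 1. *)
have J (t : R) : d <= t -> t <= b ->
    \int[mu]_(s in `[t, +oo[) (f s / s `^ (1 + a)) =
    (t `^ a)^-1 * (- (a / (1 + a)) / a + D / (t * t `^ a) / (1 + 2 * a)).
  move=> dt tb; have t0 : 0 < t by lra.
  have T0 : 0 < t `^ a by rewrite powR_gt0.
  rewrite I ?(ltW t0)// (min_l tb) (max_r dt) (min_l (le_trans tb (ltW b1))) (max_l tb).
  rewrite !P1// DE one_powR powR1D//.
  by field; rewrite !gt_eqF.
have eT (t : R) : 0 < t -> t `^ e = (t * t `^ a)^-1.
  by move=> t0; rewrite /e powRN powR1D.
apply/seteqP; split => t /=; rewrite in_itv/=; last first.
  move=> /andP[dt t1]; have t0 : 0 < t by lra.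
  have T0 : 0 < t `^ a by rewrite powR_gt0.
  split; first exact: ltW.
  have [tb|bt] := leP t b.
    rewrite J ?(ltW dt)// fE ?(ltW t0)// !indic_itvoc -/e eT//.
    have -> : (b < t) = false by lra.
    rewrite dt tb /= [X in `|X|](_ : _ = -1) ?normrN1//.
    by field; rewrite !gt_eqF.
  rewrite I ?(ltW t0)// fE ?(ltW t0)// !indic_itvoc -/e eT//.
  have -> : (t <= b) = false by lra.
  rewrite t1 bt (min_r (ltW bt)) (max_r (ltW db)) (min_l t1) (max_r (ltW bt)).
  rewrite !P1// one_powR dt /= [X in `|X|](_ : _ = 1) ?normr1//.
  by field; rewrite !gt_eqF.
move=> [t0 H].
have [t1|t1] := leP t 1; last first.
  have bt : b < t by lra.
  have dt : d < t by lra.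
  move: H; rewrite I// fE// !indic_itvoc (min_r (ltW bt)) (min_r (ltW t1)).
  rewrite (max_r (ltW db)) (max_r (ltW b1)) !(leNgt t) bt t1 !andbF /=.
  by rewrite !subrr !mulr0 !addr0 mulr0 subr0 normr0 ler10.
have [td|//] := leP t d.
have tb : t < b by lra.
have It : \int[mu]_(s in `[t, +oo[) (f s / s `^ (1 + a)) =
    (d `^ a)^-1 * (- (a / (1 + a)) / a + D / (d * d `^ a) / (1 + 2 * a)).
  rewrite -(J d (lexx d) (ltW db)) !I ?(ltW d0)// (min_l (ltW tb)) (min_l (ltW db)).
  rewrite (max_l td) maxxx (min_l t1) (min_l (ltW (lt_trans db b1))).
  by rewrite (max_l (ltW tb)) (max_l (ltW db)).
have ft : f t = 0.
  rewrite fE// !indic_itvoc !(ltNge _ t) td (ltW tb) /=.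
  by rewrite !mulr0 addr0.
have w0 : 0 <= t `^ a / d `^ a by rewrite divr_ge0// powR_ge0.
(* The weight is 0 at [t = 0] and 1 at [t = d], so both bounds are weak; strictness comes from
   [Dd]. *)
have w1 : t `^ a / d `^ a <= 1 by rewrite ler_pdivrMr// mul1r powR_le.
move: Dd; rewrite -/e eT// => Dd.
move: H; rewrite ft subr0 It leNgt => /negP[].
rewrite (_ : _ * _ * _ = t `^ a / d `^ a *
    (- (a / (1 + a)) + D / (d * d `^ a) - 1)); last first.
  by field; rewrite !gt_eqF.
rewrite normrM ger0_norm//.
apply: (@le_lt_trans _ _ `|- (a / (1 + a)) + D / (d * d `^ a) - 1|).
  by rewrite ler_piMl.
by rewrite ltr_norml; lra.
Qed.
End class_star.

(** * The two weak-type constants *)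

Section constants.
Variable R : realType.
Local Notation mu := (@lebesgue_measure R).

(** Measure and norm are given as real numbers, with the norm bounded below by a positive one, so
    the extended quotient is an ordinary division. *)
Lemma w_eq_inv (T : (R -> R) -> R -> R) (F : set (R -> R)) (theta : R) :
  0 < theta ->
  (forall f, F f -> exists l N : R,
    [/\ mu [set t : R | 0 <= t /\ 1 <= `|T f t| ] = l%:E, L1norm f = N%:E,
        0 < l & theta * l <= N]) ->
  (exists (f : R -> R) (l : R),
    [/\ F f, mu [set t : R | 0 <= t /\ 1 <= `|T f t| ] = l%:E,
        0 < l & L1norm f = (theta * l)%:E]) ->
  w T F = (theta^-1)%:E.
Proof.
move=> theta0 ub [f [l [Ff Sf l0 Nf]]].
have tl : theta * l != 0 by rewrite mulf_neq0 ?gt_eqF.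
apply/eqP; rewrite eq_le; apply/andP; split.
  apply: ge_ereal_sup => _ [g [Fg Ng0] <-].
  have [l' [N [-> -> l'0 lN]]] := ub g Fg.
  have N0 : 0 < N by apply: lt_le_trans lN; rewrite mulr_gt0.
  rewrite inver gt_eqF// -EFinM lee_fin ler_pdivrMr// -ler_pdivrMl ?invr_gt0//.
  by rewrite invrK.
apply: ereal_sup_ubound; exists f.
  by split => //; rewrite Nf => -[/eqP]; rewrite (negPf tl).
rewrite Sf Nf inver (negPf tl) -EFinM; congr (_%:E).
by field; rewrite !gt_eqF.
Qed.

(** [powR_young] at [x] and [d / c], scaled by [c]. *)
Lemma young_slack_ge0 (a x c d : R) : 0 < a -> 0 < x -> 0 < c -> 0 < d ->
  0 <= d * (d `^ a / c `^ a) + a * (x * x `^ a) * c - (1 + a) * (x `^ a * d).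
Proof.
move=> a0 x0 c0 d0.
have dc0 : 0 < d / c by rewrite divr_gt0.
have := powR_young a0 x0 dc0.
rewrite powRM ?invr_ge0 ?(ltW c0) ?(ltW d0)// powRV ?(ltW c0)//.
rewrite -(ler_pM2r c0) subr_ge0 => h.
rewrite (_ : (1 + a) * _ = (1 + a) * (x `^ a * (d / c)) * c); last first.
  by field; rewrite gt_eqF.
apply: le_trans h _; rewrite le_eqVlt; apply/orP; left; apply/eqP.
by move: (d `^ a / c `^ a) => e; field; rewrite gt_eqF.
Qed.

(** The equality case [d / c = x] of the previous slack. *)
Lemma young_slack_eq0 (a x c : R) : 0 < x -> 0 < c ->
  x * c * ((x * c) `^ a / c `^ a) + a * (x * x `^ a) * c
    - (1 + a) * (x `^ a * (x * c)) = 0.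
Proof.
move=> x0 c0; rewrite powRM ?ltW//.
by field; rewrite gt_eqF// powR_gt0.
Qed.

Lemma lebesgue_measure_itvoc (u v : R) : u < v ->
  mu `]u, v]%classic = (v - u)%:E.
Proof. by move=> uv; rewrite lebesgue_measure_itv/= lte_fin uv EFinB. Qed.

(** For any member the slacks bound the norm below by [theta * (d - 1)]. Taking [b = y], [b / c = r]
    and [d / c = x] makes all three vanish, and stationarity ensures that this choice defines a
    member of the class. *)
Lemma w_Lambda (m : nat) (theta x y r : R) : (0 < m)%N ->
  optimal_parameters (m%:R / 2) theta x y r ->
  w (@Lambda R m) (@Fclass R m) = (theta^-1)%:E.
Proof.
move=> m0 [/andP[th0 th2] [x1 y1 /andP[r0 r1]] [xE yyE] yE xxE].
have M0 : 0 < m%:R :> R by rewrite ltr0n.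
pose a : R := m%:R / 2.
have a0 : 0 < a by rewrite divr_gt0.
rewrite -/a in xE yyE yE xxE.
have x0 : 0 < x by lra. have y0 : 0 < y by lra.
have a10 : 0 < 1 + a by lra.
have k0 : 0 < (1 + a) / (1 + 2 * a) by rewrite divr_gt0//; lra.
have a_neq0 := negbT (gt_eqF a0).
have a1_neq0 : 1 + a != 0 by rewrite gt_eqF//; lra.
have a2_neq0 : 1 + 2 * a != 0 by rewrite gt_eqF//; lra.
have mE : m%:R = 2 * a by rewrite /a; field.
have PE : (2 + m%:R) / m%:R = (1 + a) / a by rewrite mE; field.
have QE : 2 * (1 + m%:R) / m%:R = (1 + 2 * a) / a by rewrite mE; field.
have D_E b : Dcoef m b = (1 + 2 * a) / a * (2 * b `^ (- a) - 1).
  by rewrite /Dcoef QE.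
(* The factors [1^a] and 1 keep the third bracket in the shape of [young_slack_ge0], with
   [c = 1]. *)
have young_bound b c d : 0 < b -> 0 < c -> 0 < d ->
    Dcoef m b * c `^ a = (1 + a) / a ->
  a / (1 + a) * (1 - 2 * b) + 2 * c - (1 + a) / a * d + d / a * (d `^ a / c `^ a)
  = theta * (d - 1) +
   (d * (d `^ a / c `^ a) + a * (x * x `^ a) * c - (1 + a) * (x `^ a * d)) / a +
   ((1 + a) / (1 + 2 * a) *
     (b * (b `^ a / c `^ a) + a * (r * r `^ a) * c - (1 + a) * (r `^ a * b)) +
     (b * (b `^ a / 1 `^ a) + a * (y * y `^ a) * 1 - (1 + a) * (y `^ a * b)))
     / (1 + a).
  move=> b0 c0 d0 Dc.
  rewrite one_powR (@slack_identity R a theta b c d (b `^ a) (c `^ a) (d `^ a)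
    (x `^ a) (y `^ a) (r `^ a) (r * r `^ a))// ?gt_eqF ?powR_gt0//; last first.
    by rewrite -Dc D_E powRN.
  by rewrite xxE yyE divr1; ring.
have lvl b d f : 1 < b -> b < d -> 
    0 < - ((1 + a) / a) + Dcoef m b * d `^ a < 2 ->
    (forall t, 0 <= t -> f t =
    ((1 + a) / a - (1 + 2 * a) / a * t `^ a) * \1_(`]1, b]) t +
    (- ((1 + a) / a) + Dcoef m b * t `^ a) * \1_(`]b, d]) t) ->
    mu [set t : R | 0 <= t /\ 1 <= `|Lambda m f t| ] = (d - 1)%:E.
  move=> b1 bd Dd fE.
  have := Fclass_level a0 b1 bd (D_E b) Dd fE.
  rewrite /Lambda -/a mE => ->.
  by rewrite lebesgue_measure_itvoc//; lra.
apply: w_eq_inv => //.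
  move=> f [b [d [/andP[b1 bd] D0 Db Dd fE]]].
  rewrite -/a PE in Db Dd.
  have {}fE t : 0 <= t -> f t =
      ((1 + a) / a - (1 + 2 * a) / a * t `^ a) * \1_(`]1, b]) t +
      (- ((1 + a) / a) + Dcoef m b * t `^ a) * \1_(`]b, d]) t.
    by move=> t0; rewrite fE// PE QE.
  (* The zero of [f] on its second piece; the sign conditions at [b] and [d] place it between
     them. *)
  pose c := ((1 + a) / a / Dcoef m b) `^ a^-1.
  have p0 : 0 < (1 + a) / a / Dcoef m b by rewrite !divr_gt0//; lra.
  have c0 : 0 < c by rewrite powR_gt0.
  have Dc : Dcoef m b * c `^ a = (1 + a) / a.
    rewrite /c -powRrM mulVf// powRr1 ?(ltW p0)//.
    by rewrite mulrC divfK// gt_eqF.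
  have b0 : 0 < b by lra. have d0 : 0 < d by lra.
  have bc : b < c.
    apply: (lt_powR_inv a0 (ltW c0)); rewrite -(ltr_pM2l D0) Dc; lra.
  have cd : c < d.
    apply: (lt_powR_inv a0 (ltW d0)); rewrite -(ltr_pM2l D0) Dc.
    by case/andP: Dd => Dd _; lra.
  exists (d - 1); eexists; split.
  - exact: lvl Dd fE.
  - exact: (Fclass_L1norm a0 b1 bc cd (D_E b) Dc fE).
  - by lra.
  rewrite young_bound// -addrA lerDl addr_ge0//.
    by rewrite divr_ge0 ?(ltW a0)// young_slack_ge0.
  rewrite divr_ge0 ?(ltW a10)// addr_ge0 ?young_slack_ge0//.
  by rewrite mulr_ge0 ?(ltW k0)// young_slack_ge0.
pose c := y / r; pose d := x * c.
have c0 : 0 < c by rewrite divr_gt0.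
have d0 : 0 < d by rewrite mulr_gt0.
have yc : y < c by rewrite /c ltr_pdivlMr// gtr_pMr.
have cd : c < d by rewrite /d ltr_pMl.
have yr : r * c = y by rewrite /c mulrC divfK// gt_eqF.
have Y0 : 0 < y `^ a by rewrite powR_gt0.
have R0 : 0 < r `^ a by rewrite powR_gt0.
(* The equation for [y^a] gives the sign of [D] and makes [y / r] the zero. *)
have D_y : Dcoef m y = (1 + 2 * a) / a * ((1 + a) / (1 + 2 * a) * r `^ a / y `^ a).
  have -> : (1 + a) / (1 + 2 * a) * r `^ a = 2 - y `^ a by rewrite yE; ring.
  by rewrite D_E powRN; field; rewrite a_neq0 gt_eqF.
have D0 : 0 < Dcoef m y.
  by rewrite D_y; apply: mulr_gt0; apply: divr_gt0 => //; [lra|exact: mulr_gt0].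
have Dc : Dcoef m y * c `^ a = (1 + a) / a.
  rewrite D_y /c powRM ?invr_ge0 ?(ltW y0) ?(ltW r0)// powRV ?(ltW r0)//.
  by field; rewrite !gt_eqF//; lra.
(* By the equation for [x^a], the value of the extremal function at [d] is [theta]; the class
   requires it to lie in []0, 2[]. *)
have Dd : Dcoef m y * d `^ a = (1 + a) / a + theta.
  rewrite /d powRM ?(ltW x0) ?(ltW c0)// mulrCA Dc xE; field.
  by rewrite a_neq0.
pose f t := ((1 + a) / a - (1 + 2 * a) / a * t `^ a) * \1_(`]1, y]) t +
      (- ((1 + a) / a) + Dcoef m y * t `^ a) * \1_(`]y, d]) t.
exists f, (d - 1); split.
- exists y, d; rewrite -/a PE QE; split => //.
  + by rewrite y1 (lt_trans yc).
  + have : Dcoef m y * y `^ a < Dcoef m y * c `^ a.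
      by rewrite ltr_pM2l// powR_lt// ltW.
    by rewrite Dc; lra.
  + by rewrite Dd; lra.
- by apply: (lvl y d f y1 (lt_trans yc cd)) => //; rewrite Dd; lra.
- by lra.
rewrite (@Fclass_L1norm R a y c d (Dcoef m y) f)// young_bound//.
have E1 := young_slack_eq0 a x0 c0; rewrite -/d in E1.
have E2 := young_slack_eq0 a r0 c0; rewrite yr in E2.
have E3 := young_slack_eq0 a y0 ltr01; rewrite mulr1 in E3.
by rewrite E1 E2 E3 mulr0 !addr0 !mul0r !addr0.
Qed.

End constants.

(** The scheme is that of [w_Lambda] with [x] and [y] exchanging tasks: the equation for [x^(1+a)]
    now locates the zero, and the one for [y^(1+a)] gives the boundary value. *)
Lemma w_Lambda_star (R : realType) (m : nat) (theta x y r : R) : (0 < m)%N ->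
  optimal_parameters (m%:R / 2) theta x y r ->
  w (@Lambda_star R m) (@Fclass_star R m) = (theta^-1)%:E.
Proof.
move=> m0 [/andP[th0 th2] [x1 y1 /andP[r0 r1]] [xE yyE] yE xxE].
have M0 : 0 < m%:R :> R by rewrite ltr0n.
pose a : R := m%:R / 2.
have a0 : 0 < a by rewrite divr_gt0.
rewrite -/a in xE yyE yE xxE.
have x0 : 0 < x by lra. have y0 : 0 < y by lra.
have a10 : 0 < 1 + a by lra.
have a20 : 0 < 1 + 2 * a by lra.
have k0 : 0 < a / (1 + 2 * a) by rewrite divr_gt0.
have p0 : 0 < a / (1 + a) by rewrite divr_gt0.
have a_neq0 := negbT (gt_eqF a0).
have a1_neq0 := negbT (gt_eqF a10).
have a2_neq0 := negbT (gt_eqF a20).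
have mE : m%:R = 2 * a by rewrite /a; field.
have M2 : 2 + m%:R = 2 * (1 + a) by rewrite mE; ring.
have PE : m%:R / (2 + m%:R) = a / (1 + a) by rewrite M2 mE; field.
have QE : 2 * (1 + m%:R) / (2 + m%:R) = (1 + 2 * a) / (1 + a).
  by rewrite M2 mE; field.
have NE : - 1 - a = - (1 + a) by ring.
have D_E b : Dcoef_star m b = (1 + 2 * a) / (1 + a) * (2 * b `^ (1 + a) - 1).
  by rewrite /Dcoef_star QE.
have young_bound b c d : 0 < b -> 0 < c -> 0 < d ->
    Dcoef_star m b * c `^ (- (1 + a)) = a / (1 + a) ->
  a / (1 + a) * d - 2 * c + (1 + a) / a * (2 * b - 1) +
    c * (c `^ a / d `^ a) / (1 + a)
  = theta * (1 - d) +
   (c * (c `^ a / d `^ a) + a * (y * y `^ a) * d - (1 + a) * (y `^ a * c))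
     / (1 + a) +
   ((1 * (1 `^ a / b `^ a) + a * (x * x `^ a) * b - (1 + a) * (x `^ a * 1)) +
    a / (1 + 2 * a) *
     (c * (c `^ a / b `^ a) + a * (r * r `^ a) * b - (1 + a) * (r `^ a * c))) / a.
  move=> b0 c0 d0 Dc.
  have C0 : 0 < c `^ a by rewrite powR_gt0.
  rewrite one_powR (@slack_identity_star R a theta b c d (b `^ a) (c `^ a)
    (d `^ a) (x `^ a) (y `^ a) (r `^ a) (r * r `^ a))//
    ?gt_eqF ?powR_gt0//; last first.
    by rewrite -Dc D_E powRN !powR1D//; field; rewrite a1_neq0 !gt_eqF.
  by rewrite xxE yyE div1r; ring.
have lvl b d f : 0 < d -> d < b -> b < 1 ->
    0 < - (a / (1 + a)) + Dcoef_star m b * d `^ (- (1 + a)) < 2 ->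
    (forall t, 0 <= t -> f t =
    (- (a / (1 + a)) + Dcoef_star m b * t `^ (- (1 + a))) * \1_(`]d, b]) t +
    (a / (1 + a) - (1 + 2 * a) / (1 + a) * t `^ (- (1 + a))) * \1_(`]b, 1]) t) ->
    (@lebesgue_measure R) [set t : R | 0 <= t /\ 1 <= `|Lambda_star m f t| ]
    = (1 - d)%:E.
  move=> d0 db b1 Dd fE.
  have := Fclass_star_level a0 d0 db b1 (D_E b) Dd fE.
  rewrite /Lambda_star -/a mE => ->.
  by rewrite lebesgue_measure_itvoc//; lra.
apply: w_eq_inv => //.
  move=> f [b [d [[/andP[d0 db] b1] D0 Db Dd fE]]].
  rewrite -/a PE NE in Db Dd.
  have {}fE t : 0 <= t -> f t =
    (- (a / (1 + a)) + Dcoef_star m b * t `^ (- (1 + a))) * \1_(`]d, b]) t +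
    (a / (1 + a) - (1 + 2 * a) / (1 + a) * t `^ (- (1 + a))) * \1_(`]b, 1]) t.
    by move=> t0; rewrite fE// PE QE NE.
  pose c := (Dcoef_star m b / (a / (1 + a))) `^ (1 + a)^-1.
  have q0 : 0 < Dcoef_star m b / (a / (1 + a)) by rewrite divr_gt0.
  have c0 : 0 < c by rewrite powR_gt0.
  have Dc : Dcoef_star m b * c `^ (- (1 + a)) = a / (1 + a).
    rewrite powRN /c -powRrM mulVf// powRr1 ?(ltW q0)// invf_div mulrCA.
    by rewrite mulfV ?mulr1// gt_eqF.
  have b0 : 0 < b by lra.
  have lt_of_inv s t : 0 < s -> 0 < t ->
      Dcoef_star m b * t `^ (- (1 + a)) < Dcoef_star m b * s `^ (- (1 + a)) ->
      s < t.
    move=> s0 t0; rewrite ltr_pM2l// !powRN ltf_pV2 ?posrE ?powR_gt0//.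
    exact: lt_powR_inv a10 (ltW t0).
  have cb : c < b by apply: lt_of_inv => //; rewrite Dc; lra.
  have dc : d < c.
    by apply: lt_of_inv => //; rewrite Dc; case/andP: Dd => Dd _; lra.
  exists (1 - d); eexists; split.
  - exact: lvl Dd fE.
  - exact: (Fclass_star_L1norm a0 d0 dc cb b1 (D_E b) Dc fE).
  - by lra.
  rewrite young_bound// -addrA lerDl addr_ge0//.
    by rewrite divr_ge0 ?(ltW a10)// young_slack_ge0.
  rewrite divr_ge0 ?(ltW a0)// addr_ge0 ?young_slack_ge0//.
  by rewrite mulr_ge0 ?(ltW k0)// young_slack_ge0.
(* These ratios are the equality cases of the three slacks. *)
pose b := x^-1; pose c := r * b; pose d := c / y.
have b0 : 0 < b by rewrite invr_gt0.
have b1 : b < 1 by rewrite invf_lt1.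
have c0 : 0 < c by rewrite mulr_gt0.
have d0 : 0 < d by rewrite divr_gt0.
have cb : c < b by rewrite /c gtr_pMl.
have dc : d < c by rewrite /d ltr_pdivrMr// ltr_pMr.
have X0 : 0 < x `^ a by rewrite powR_gt0.
have Y0 : 0 < y `^ a by rewrite powR_gt0.
have R0 : 0 < r `^ a by rewrite powR_gt0.
have D_b : Dcoef_star m b =
    (1 + 2 * a) / (1 + a) * (a / (1 + 2 * a) * (r * r `^ a) / (x * x `^ a)).
  have -> : a / (1 + 2 * a) * (r * r `^ a) = 2 - x * x `^ a by rewrite xxE; ring.
  rewrite D_E powR1D// /b powRV ?(ltW x0)//.
  by field; rewrite a1_neq0 !gt_eqF.
have D0 : 0 < Dcoef_star m b.
  rewrite D_b; apply: mulr_gt0; apply: divr_gt0 => //; last exact: mulr_gt0.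
  by apply: mulr_gt0 => //; exact: mulr_gt0.
have Dc : Dcoef_star m b * c `^ (- (1 + a)) = a / (1 + a).
  rewrite D_b powRN powR1D// /c powRM ?(ltW r0) ?(ltW b0)// /b powRV ?(ltW x0)//.
  by field; rewrite a1_neq0 a2_neq0 !gt_eqF.
(* Once more the boundary value at [d], here a right limit, is [theta]. *)
have Dd : Dcoef_star m b * d `^ (- (1 + a)) = a / (1 + a) + theta.
  have -> : d `^ (- (1 + a)) = c `^ (- (1 + a)) * (y * y `^ a).
    rewrite !powRN !powR1D// /d powRM ?invr_ge0 ?(ltW c0) ?(ltW y0)//.
    by rewrite powRV ?(ltW y0)//; field; rewrite !gt_eqF ?powR_gt0.
  by rewrite mulrA Dc yyE; field; rewrite a_neq0 a1_neq0.
pose f t :=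
    (- (a / (1 + a)) + Dcoef_star m b * t `^ (- (1 + a))) * \1_(`]d, b]) t +
    (a / (1 + a) - (1 + 2 * a) / (1 + a) * t `^ (- (1 + a))) * \1_(`]b, 1]) t.
exists f, (1 - d); split.
- exists b, d; rewrite -/a PE QE NE; split => //.
  + by rewrite d0 (lt_trans dc cb).
  + have : Dcoef_star m b * b `^ (- (1 + a)) < Dcoef_star m b * c `^ (- (1 + a)).
      by rewrite ltr_pM2l// !powRN ltf_pV2 ?posrE ?powR_gt0// powR_lt// ltW.
    by rewrite Dc; lra.
  + by rewrite Dd; lra.
- by apply: (lvl b d f d0 (lt_trans dc cb) b1) => //; rewrite Dd; lra.
- by lra.
rewrite (@Fclass_star_L1norm R a b c d (Dcoef_star m b) f)// young_bound//.
have E1 := young_slack_eq0 a y0 d0.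
rewrite (_ : y * d = c) in E1; last by rewrite /d mulrC divfK// gt_eqF.
have E2 := young_slack_eq0 a x0 b0.
rewrite (_ : x * b = 1) in E2; last by rewrite /b mulfV// gt_eqF.
have E3 := young_slack_eq0 a r0 b0; rewrite -/c in E3.
by rewrite E1 E2 E3 mulr0 !mul0r !addr0 mul0r addr0.
Qed.

Theorem mainTheorem3 (R : realType) (m : nat) (hm : (0 < m)%N) :
  w (@Lambda_star R m) (@Fclass_star R m) = w (@Lambda R m) (@Fclass R m).
Proof.
have a0 : 0 < m%:R / 2 :> R by rewrite divr_gt0// ltr0n.
(* A single tuple serves both operators, so both constants are the inverse of the same [theta]. *)
have [theta [x [y [r P]]]] := exists_optimal_parameters a0.
by rewrite (w_Lambda_star hm P) (w_Lambda hm P).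
Qed.
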